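(* Let $\alpha(x)$ be an eventually positive sub-polynomial of the form $$\alpha(x)=c\,p(x)+r(x),$$ where $c>0$ is real, $p\in\mathbb{Z}[x]$ has degree $\geq 2$, and $\lim_{x\to+\infty}\frac{|r(x)|}{\log(x)}<+\infty$. Then there exists $A\subseteq\mathbb{N}$ such that $\overline{d}(A)>0$ and there are no $x,y\in A$, $n\in\mathbb{N}$ such that $x+y=\lfloor\alpha(n)\rfloor$.
   Context: $\mathbb{N}=\{1,2,\dots\}$. For $A\subseteq\mathbb{N}$, $\overline{d}(A)=\limsup_{N\to\infty}\frac{|A\cap[1,N]|}{N}$. Let $\mathcal{G}$ be the ring (under pointwise addition and multiplication) of germs at $+\infty$ of continuous real-valued functions defined on half-lines $(a,+\infty)$; two functions have the same germ if they agree for all sufficiently large $x$. A Hardy field is a subfield of $\mathcal{G}$ closed under differentiation (each element is eventually differentiable and its derivative's germ lies in the field). A sub-polynomial is a function $\alpha$ whose germ belongs to some Hardy field and which satisfies $\lim_{x\to+\infty}\alpha(x)/x^l=0$ for some $l>0$. Functions and germs are not distinguished; when values $\alpha(n)$, $n\in\mathbb{N}$, appear, $\alpha$ denotes a fixed real-valued representative defined on $[1,+\infty)$. *)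

(* Defs.v *)
From mathcomp Require Import all_boot all_order all_algebra finmap.
From mathcomp Require Import all_classical all_reals all_analysis.

Set Implicit Arguments.
Unset Strict Implicit.
Unset Printing Implicit Defensive.

Import Order.TTheory GRing.Theory Num.Theory.
Import numFieldNormedType.Exports.

Local Open Scope classical_set_scope.
Local Open Scope ring_scope.

Definition germ_eq (R : realType) (f g : R -> R) : Prop :=
  \forall x \near +oo_R, f x = g x.

(* A set of germs is represented by the set of all total functions R -> R whose
   germ it contains; [hardy_germ] says that [H] is saturated in this sense. The
   values of a function outside the half-line where it is meaningful are
   arbitrary. *)
Record hardy_field (R : realType) (H : set (R -> R)) : Prop := HardyField {
  hardy_germ : forall f g, germ_eq f g -> H f -> H g;
  hardy_continuous : forall f, H f ->
    \forall x \near +oo_R, {for x, continuous f};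
  hardy1 : H (fun=> 1);
  hardyB : forall f g, H f -> H g -> H (f \- g);
  hardyM : forall f g, H f -> H g -> H (f \* g);
  hardyV : forall f, H f -> ~ germ_eq f (fun=> 0) ->
    exists2 g, H g & germ_eq (f \* g) (fun=> 1);
  hardy_derivable : forall f, H f -> \forall x \near +oo_R, derivable f x 1;
  hardy_derive : forall f, H f -> H (derive1 f)
}.

Definition sub_polynomial (R : realType) (f : R -> R) : Prop :=
  (exists2 H : set (R -> R), hardy_field H & H f) /\
  (exists2 l : R, 0 < l & f x / x `^ l @[x --> +oo_R] --> 0).

(* Extended-real valued only because [limn_esup] is; the term of index 0 is a
   junk value, irrelevant to the limit superior. *)
Definition upper_density (R : realType) (A : set nat) : \bar R :=
  limn_esup (fun N : nat =>
    (#|` fset_set (A `&` [set k | (1 <= k <= N)%N])|%:R / N%:R : R)%:E).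

(* Main.v *)
Require Import Defs.
From mathcomp Require Import all_boot all_order all_algebra finmap.
From mathcomp Require Import all_classical all_reals all_analysis.
From mathcomp Require Import zify ring lra.
Import Order.TTheory GRing.Theory Num.Theory.
Import numFieldNormedType.Exports.
Local Open Scope classical_set_scope.
Local Open Scope ring_scope.

(* For every [K] some modulus [M] has [K] consecutive residues missed by [p]:
   if a prime [q] divides [p'(a)], then [p(a + q) = p(a)] mod [q^2], so [p] misses
   a residue mod [q^2], and infinitely many such moduli are combined by the
   Chinese remainder theorem.  On the other hand [r = alpha - c p] is eventually
   monotone (a high derivative of it lies in the Hardy field) and [O(log)], so on
   infinitely many scales [B^k <= x <= B^(k+1)] it stays within [V] of a constant
   [rho].  On such a scale [alpha(n) / c] is, mod [M], within a bounded distance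
   of [rho / c] plus a value of [p], hence avoids a window; the set [A] consists,
   on those scales, of the integers [ceil (c (M m + u / 2))], where [u] places the
   sums [x + y] in the window.  By pigeonhole the residue [u] can be taken to be
   the same on infinitely many scales. *)

(** * Runs of residues missed by a polynomial *)

(** Divided derivatives keep the coefficient [y] of the remainder in [S], so over the integers this
    is a congruence modulo [h ^+ 2]. *)
Lemma horner_taylor2 (S : comNzRingType) (p : {poly S}) (x h : S) :
  exists y, p.[x + h] = p.[x] + p^`().[x] * h + y * h ^+ 2.
Proof.
have sp : (size p <= (size p).+2)%N by rewrite ltnW.
rewrite (nderiv_taylor_wide (mulrC x h) sp) !big_ord_recl /= /bump /=.
exists (\sum_(i < size p) p^`N(i.+2).[x] * h ^+ i).
rewrite nderivn0 nderivn1 expr0 expr1 mulr1 addrA; congr (_ + _).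
rewrite mulr_suml; apply: eq_bigr => i _.
by rewrite -mulrA -exprD addn2.
Qed.

(** The values [b * j] with [j < size g] are distinct, and [g] has fewer than [size g] roots. *)
Lemma nonroot_multiple (g : {poly int}) (b : int) :
  g != 0 -> b != 0 -> exists j : nat, ~~ root g (b * j%:Z).
Proof.
move=> g0 b0.
pose rs := [seq b * (j%:Z) | j <- iota 0 (size g)].
have /allPn[_ /mapP[j _ ->] nr] : ~~ all (root g) rs.
  apply/negP => /(max_poly_roots g0).
  rewrite map_inj_uniq ?iota_uniq; last by move=> i j /(mulfI b0) [].
  by rewrite size_map size_iota ltnn => /(_ isT).
by exists j.
Qed.

(* Schur: if [f 0 <> 0], then [f (f 0 * B! * j) = f 0 * (1 + B! * _)], and the
   second factor is coprime to every prime up to [B]. *)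
Lemma prime_dvd_poly_value (f : {poly int}) (B : nat) : (1 < size f)%N ->
  exists q : nat, exists a : int,
    [/\ prime q, (B < q)%N & (q %| f.[a])%Z].
Proof.
move=> sf; have [q0 Bq0 pq0] := prime_above B.
have [f0|f0] := eqVneq f.[0] 0.
  by exists q0, 0; split => //; rewrite f0 dvdz0.
have Bf0 : B`!%:Z != 0 by rewrite -lt0n fact_gt0.
pose b : int := f.[0] * B`!%:Z.
have b0 : b != 0 by rewrite mulf_neq0.
have fc c : f + c%:P != 0.
  apply: contraTneq sf => /eqP; rewrite addr_eq0 => /eqP ->.
  by rewrite size_polyN -leqNgt size_polyC_leq1.
(* At a nonroot of this product [f] is neither [f.[0]] nor [- f.[0]], so the factor [w] below is
   neither 1 nor -1. *)
have gN : (f - f.[0]%:P) * (f + f.[0]%:P) != 0 by rewrite -polyCN mulf_neq0.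
have [j] := nonroot_multiple _ _ gN b0.
rewrite rootM /root !hornerE negb_or => /andP[nj1 nj2].
have [fa0|fa0] := eqVneq f.[b * j%:Z] 0.
  by exists q0, (b * j%:Z); split => //; rewrite fa0 dvdz0.
have [y yE] := horner_taylor2 _ f 0 (b * j%:Z).
rewrite add0r in yE.
pose z : int := j%:Z * (f^`().[0] + y * (b * j%:Z)).
pose w : int := 1 + B`!%:Z * z.
have fE : f.[b * j%:Z] = f.[0] * w by rewrite yE /w /z /b; ring.
have w1 : (1 < `|w|)%N.
  rewrite ltnNge; apply/negP => le1; move: nj1 nj2 fa0; rewrite fE.
  have [->|[->|->]] : w = 0 \/ w = 1 \/ w = -1 by lia.
  - by rewrite mulr0 eqxx.
  - by rewrite mulr1 subrr eqxx.
  - by rewrite mulrN1 addNr eqxx.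
have [q pq qw] := pdivP w1.
exists q, (b * j%:Z); split => //; last by rewrite fE dvdz_mull.
rewrite ltnNge; apply/negP => qB.
have qB' : (q %| B`!%:Z * z)%Z.
  by apply: dvdz_mulr; rewrite dvdzE /= dvdn_fact ?qB ?prime_gt0.
have : (q %| w - B`!%:Z * z)%Z by apply: rpredB.
by rewrite /w addrK dvdz1 /= => /eqP q1; rewrite q1 in pq.
Qed.

Definition missed_residue (p : {poly int}) (m t : int) :=
  forall a : int, ~ (m %| p.[a] - t)%Z.

Lemma dvdz_horner_sub (p : {poly int}) (m a b : int) :
  (m %| a - b)%Z -> (m %| p.[a] - p.[b])%Z.
Proof.
move=> mab; have [y] := horner_taylor2 _ p b (a - b).
rewrite addrC subrK => ->.
have -> : p.[b] + p^`().[b] * (a - b) + y * (a - b) ^+ 2 - p.[b] =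
  (p^`().[b] + y * (a - b)) * (a - b) by ring.
exact: dvdz_mull.
Qed.

(* [p] takes the same value mod [q^2] at [a] and [a + q]; a self-map of
   [Z / q^2] that is not injective is not surjective. *)
Lemma missed_residue_square (p : {poly int}) (q : nat) (a : int) :
  (1 < q)%N -> (q %| p^`().[a])%Z ->
  exists t, missed_residue p (q ^ 2)%N t.
Proof.
move=> q1 qa; pose m := (q ^ 2)%N.
have m0 : (0 < m)%N by rewrite expn_gt0 ltnW.
have mz0 : m%:Z != 0 by rewrite -lt0n.
have rP (x : int) : (`|(x %% m)%Z| < m)%N.
  by rewrite -ltz_nat gez0_abs ?modz_ge0 // ltz_pmod.
pose rs (x : int) : 'I_m := Ordinal (rP x).
have rsE x : (rs x)%:Z = (x %% m)%Z by rewrite /= gez0_abs ?modz_ge0.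
have ordZ_inj (i j : 'I_m) : i%:Z = j%:Z -> i = j by move=> [] /val_inj.
pose F (i : 'I_m) : 'I_m := rs p.[i%:Z].
have Frs x : F (rs x) = rs p.[x].
  apply: ordZ_inj; rewrite /F !rsE; apply/eqP; rewrite eqz_mod_dvd dvdz_horner_sub //.
  by rewrite -eqz_mod_dvd modz_mod.
have [/forallP surj|/forallPn[t nt]] := boolP [forall t, t \in codom F]; last first.
  exists t%:Z => x /= mx; move/negP: nt; apply; apply/codomP; exists (rs x).
  rewrite Frs; apply: ordZ_inj; rewrite rsE.
  move: mx; rewrite -eqz_mod_dvd => /eqP ->.
  by rewrite modz_small //= ltz_nat ltn_ord.
have Finj : injective F.
  apply/injectiveP/card_uniqP.
  rewrite size_map -cardE; apply/eq_card => t.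
  by rewrite surj.
(* In the Taylor expansion at [a] both the linear term and the remainder are multiples of [q ^ 2].
   Injectivity would then make [q ^ 2] divide [q]. *)
have : rs (a + q%:Z) = rs a.
  apply: Finj; rewrite !Frs; apply: ordZ_inj.
  rewrite !rsE; apply/eqP; rewrite eqz_mod_dvd.
  have [y ->] := horner_taylor2 _ p a q%:Z.
  rewrite -(addrA p.[a]) [_ - p.[a]]addrC addKr rpredD //.
    by rewrite /m -mulnn PoszM dvdz_mul.
  by rewrite dvdz_mull.
move=> /(congr1 (fun i : 'I_m => i%:Z)); rewrite !rsE => /eqP.
rewrite eqz_mod_dvd addrC addKr dvdzE /= /m -[X in (_ %| X)%N]expn1.
by rewrite dvdn_Pexp2l.
Qed.

(** Induction on [K]: a prime [q > M] is coprime to [M], so the run modulo [M] can be lifted so that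
    its next term falls on a residue missed modulo [q ^ 2]. The clause [K <= M] serves to make [M]
    as large as desired. *)
Lemma missed_residue_run (p : {poly int}) (K : nat) : (2 < size p)%N ->
  exists M : nat, exists s : int, [/\ (0 < M)%N, (K <= M)%N &
    forall i : nat, (i < K)%N -> missed_residue p M (s + i%:Z)].
Proof.
move=> sp; elim: K => [|K [M [s [M0 KM IH]]]]; first by exists 1%N, 0.
have sp' : (1 < size p^`())%N.
  rewrite ltnNge; apply/negP => le1.
  have p0 : p != 0 by rewrite -size_poly_gt0 (ltn_trans _ sp).
  have s2 : (1 <= (size p).-2)%N by lia.
  have /eqP := nth_default 0 (leq_trans le1 s2).
  rewrite coef_deriv mulrn_eq0 /= prednK; last by rewrite -subn1 subn_gt0 ltnW.
  by rewrite -/(lead_coef p) lead_coef_eq0 (negbTE p0).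
have [q [a [pq Mq qa]]] := prime_dvd_poly_value _ M sp'.
have [t mt] := missed_residue_square _ _ _ (prime_gt1 pq) qa.
have cop : coprimez M (q ^ 2)%N.
  rewrite coprimezE /= coprime_pexpr // coprime_sym prime_coprime //.
  by apply/negP => /(dvdn_leq M0); rewrite leqNgt Mq.
exists (M * q ^ 2)%N, (zchinese M (q ^ 2)%N s (t - K%:Z)).
set s' := zchinese _ _ _ _.
have q0 := prime_gt1 pq.
split; [by rewrite muln_gt0 M0 expn_gt0 ltnW | by nia |].
have sM : (M %| s' - s)%Z by rewrite -eqz_mod_dvd zchinese_modl.
have sq : ((q ^ 2)%N %| s' - (t - K%:Z))%Z.
  by rewrite -eqz_mod_dvd zchinese_modr.
move=> i; rewrite ltnS leq_eqVlt => /orP[/eqP ->|iK] x; rewrite PoszM => xM.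
  apply: (mt x).
  have -> : p.[x] - t = (p.[x] - (s' + K%:Z)) + (s' - (t - K%:Z)) by ring.
  by apply: rpredD => //; apply: dvdz_trans xM; rewrite dvdz_mull.
apply: (IH i iK x).
have -> : p.[x] - (s + i%:Z) = (p.[x] - (s' + i%:Z)) + (s' - s) by ring.
by apply: rpredD => //; apply: dvdz_trans xM; rewrite dvdz_mulr.
Qed.

(** * Germs at infinity and Hardy fields *)

Lemma near_pinftyP {R : realType} (P : R -> Prop) :
  (\forall x \near +oo_R, P x) <-> exists M, forall x, M < x -> P x.
Proof.
split=> [[M [_ MP]]|[M MP]]; first by exists M.
by exists M; split => //; exact: num_real.
Qed.

Definition eventually_signed {R : realType} (f : R -> R) :=
  (\forall x \near +oo_R, 0 <= f x) \/ (\forall x \near +oo_R, f x <= 0).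

Definition eventually_ndecr {R : realType} (f : R -> R) :=
  exists a, forall x y, a < x -> x <= y -> f x <= f y.

Lemma eventually_ndecr_signed {R : realType} (f : R -> R) :
  eventually_ndecr f -> eventually_signed f.
Proof.
move=> [a fa]; have [[x ax fx]|nf] := pselect (exists2 x, a < x & 0 <= f x).
  left; apply/near_pinftyP; exists x => y xy.
  by apply: le_trans fx _; apply: fa => //; exact: ltW.
right; apply/near_pinftyP; exists a => x ax.
by rewrite leNgt; apply/negP => fx; apply: nf; exists x => //; exact: ltW.
Qed.

Lemma eventually_ndecr_of_derive {R : realType} (f : R -> R) :
  (\forall x \near +oo_R, derivable f x 1) ->
  (\forall x \near +oo_R, 0 <= derive1 f x) -> eventually_ndecr f.
Proof.
move=> df f'0; have [M MP] := (near_pinftyP _).1 (filterI df f'0).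
exists M => x y Mx.
have dfx z : x <= z -> derivable f z 1 by move=> xz; apply MP; exact: lt_le_trans xz.
apply: (@ger0_derive1_ndecry _ _ x) => //.
- by move=> z; rewrite in_itv /= andbT => /ltW; exact: dfx.
- move=> z; rewrite in_itv /= andbT => xz.
  by have [] := MP _ (lt_trans Mx xz).
- apply: derivable_within_continuous => z.
  by rewrite in_itv /= andbT; exact: dfx.
Qed.

Lemma eventually_monotone_of_derive {R : realType} (f : R -> R) :
  (\forall x \near +oo_R, derivable f x 1) -> eventually_signed (derive1 f) ->
  eventually_ndecr f \/ eventually_ndecr (- f).
Proof.
move=> df [f'0|f'0]; [left|right]; first exact: eventually_ndecr_of_derive.
apply: eventually_ndecr_of_derive; first by apply: filterS df => x; exact: derivableN.
apply: filterS (filterI df f'0) => x [dfx].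
by rewrite !derive1E deriveN // oppr_ge0.
Qed.

Lemma eventually_signed_of_derive {R : realType} (f : R -> R) :
  (\forall x \near +oo_R, derivable f x 1) -> eventually_signed (derive1 f) ->
  eventually_signed f.
Proof.
move=> df /(eventually_monotone_of_derive _ df) [/eventually_ndecr_signed //|].
move=> /eventually_ndecr_signed [] h; [right|left]; apply: filterS h => x.
  by rewrite oppr_ge0.
by rewrite oppr_le0.
Qed.

Lemma eventually_signed_near_eq {R : realType} (f g : R -> R) :
  germ_eq f g -> eventually_signed f -> eventually_signed g.
Proof.
by move=> fg [] h; [left|right]; apply: filterS (filterI fg h) => x [->].
Qed.

(** A nonzero germ is invertible, hence eventually nonvanishing; by eventual continuity and the
    intermediate value theorem its sign is constant. *)
Lemma hardy_signed {R : realType} (H : set (R -> R)) (f : R -> R) :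
  hardy_field H -> H f -> eventually_signed f.
Proof.
move=> hH Hf; have [f0|nf0] := pselect (germ_eq f (fun=> 0)).
  by left; apply: filterS f0 => x ->.
have [g _ fg1] := hardyV hH Hf nf0.
have [M MP] := (near_pinftyP _).1 (filterI fg1 (hardy_continuous hH Hf)).
have nz x : M < x -> f x != 0.
  move=> /MP[/= fgx _]; apply/eqP => fx0; move: fgx; rewrite fx0 mul0r => /eqP.
  by rewrite eq_sym oner_eq0.
have M1 : M < M + 1 by rewrite ltrDl.
have ivt x : M + 1 <= x -> ~ (Num.min (f (M + 1)) (f x) <= 0 <= Num.max (f (M + 1)) (f x)).
  move=> M1x /(IVT M1x)[|y]; last first.
    rewrite in_itv /= => /andP[y1 _] fy0.
    by have := nz y (lt_le_trans M1 y1); rewrite fy0 eqxx.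
  apply: continuous_in_subspaceT => z; rewrite inE /= in_itv /= => /andP[z1 _].
  by have [] := MP _ (lt_le_trans M1 z1).
have := nz _ M1; rewrite neq_lt => /orP[f1|f1]; [right|left];
  apply/near_pinftyP; exists (M + 1) => x /ltW M1x; rewrite leNgt;
  apply/negP => fx; apply: (ivt x M1x);
  by rewrite ge_min le_max !(ltW fx, ltW f1) ?orbT.
Qed.

Lemma eventually_derivable_sub_poly {R : realType} (f : R -> R) (P : {poly R}) :
  (\forall x \near +oo_R, derivable f x 1) ->
  (\forall x \near +oo_R, derivable (f - horner P) x 1) /\
  germ_eq (derive1 f - horner P^`()) (derive1 (f - horner P)).
Proof.
move=> df; split; apply: filterS df => x dfx.
  exact: derivableB.
rewrite derivE [RHS]derive1E deriveB //.
by rewrite -!derive1E.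
Qed.

(* After [size P] differentiations [P] disappears and a germ of [H], which has
   constant sign, is left; the sign propagates back through monotonicity. *)
Lemma hardy_sub_poly_signed {R : realType} (H : set (R -> R)) (f : R -> R)
    (P : {poly R}) :
  hardy_field H -> H f -> eventually_signed (f - horner P).
Proof.
move=> hH; move: {2}(size P) (leqnn (size P)) => n.
elim: n P f => [|n IH] P f sP Hf.
  have -> : P = 0 by apply/eqP; rewrite -size_poly_leq0.
  by rewrite horner0_ext subr0; exact: hardy_signed Hf.
have [d e] := eventually_derivable_sub_poly f P (hardy_derivable hH Hf).
apply: eventually_signed_of_derive => //.
apply: eventually_signed_near_eq e _; apply: IH; last exact: hardy_derive.
have [->|P0] := eqVneq P 0; first by rewrite deriv0 size_poly0.
by rewrite -ltnS (leq_trans (lt_size_deriv P0)).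
Qed.

(** [horner P] need not lie in [H], but the derivative of the difference is again an element of [H]
    minus a polynomial, so its sign is known. *)
Lemma hardy_sub_poly_monotone {R : realType} (H : set (R -> R)) (f : R -> R)
    (P : {poly R}) : hardy_field H -> H f ->
  eventually_ndecr (f - horner P) \/ eventually_ndecr (- (f - horner P)).
Proof.
move=> hH Hf.
have [d e] := eventually_derivable_sub_poly f P (hardy_derivable hH Hf).
apply: eventually_monotone_of_derive => //.
apply: eventually_signed_near_eq e _.
exact: hardy_sub_poly_signed hH (hardy_derive hH Hf).
Qed.

(** * Growth and slow variation *)

Lemma horner_sub_lead_le {R : realFieldType} (P : {poly R}) (d : nat) :
  size P = d.+2 -> exists a, forall x, 1 <= x ->
    `|P.[x] - lead_coef P * x ^+ d.+1| <= a * x ^+ d.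
Proof.
move=> sP; exists (\sum_(i < d.+1) `|P`_i|) => x x1.
rewrite horner_coef sP big_ord_recr /= lead_coefE sP addrK.
rewrite (le_trans (ler_norm_sum _ _ _)) // mulr_suml ler_sum // => i _.
have x0 : 0 <= x by rewrite (le_trans _ x1).
rewrite normrM ler_wpM2l // normrX (ger0_norm x0).
by rewrite ler_weXn2l // -ltnS.
Qed.

Lemma near_ge {R : realType} (a : R) : \forall x \near +oo_R, a <= x.
Proof. exact: nbhs_pinfty_ge (num_real a). Qed.

Lemma eventually_bounded_by_ln {R : realType} (r : R -> R) (l : R) :
  `|r x| / ln x @[x --> +oo_R] --> l ->
  exists2 C, 0 <= C & \forall x \near +oo_R, `|r x| <= C * ln x.
Proof.
move=> rl; exists (`|l| + 1); first by rewrite addr_ge0.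
have := cvgr_dist_lt _ _ rl.
move=> /(_ _ 1 ltr01) h.
apply: filterS (filterI (near_ge 2) h) => x [x2 /=].
have lx : 0 < ln x by rewrite ln_gt0 // (lt_le_trans _ x2) // ltr1n.
move=> hx; rewrite -ler_pdivrMr //.
have := ler_norm l.
by move: hx; rewrite ltr_distlC => /andP[_ h1] h2; lra.
Qed.

(** The lower-degree terms and the logarithm are [O(x ^ (d + 1))], so the leading term dominates;
    its coefficient is positive because [alpha] is. *)
Lemma sub_poly_growth {R : realType} (alpha r : R -> R) (P : {poly R}) (d : nat)
    (C : R) :
  size P = d.+3 -> 0 <= C ->
  (\forall x \near +oo_R, 0 < alpha x) ->
  (\forall x \near +oo_R, alpha x = P.[x] + r x) ->
  (\forall x \near +oo_R, `|r x| <= C * ln x) ->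
  exists2 b, 0 < b & \forall x \near +oo_R,
    b * x ^+ d.+2 <= alpha x <= 4 * b * x ^+ d.+2.
Proof.
move=> sP C0 a0 aE rC; have [a aP] := horner_sub_lead_le P d.+1 sP.
pose L := lead_coef P.
have L0 : L != 0 by rewrite lead_coef_eq0 -size_poly_gt0 sP.
have nL : 0 < `|L| by rewrite normr_gt0.
have dom : \forall x \near +oo_R, 0 < x ^+ d.+2 /\
    `|alpha x - L * x ^+ d.+2| <= `|L| / 2 * x ^+ d.+2.
  have := near_ge ((a + C) * 2 / `|L|) => nr.
  apply: filterS (filterI (near_ge 2) (filterI nr (filterI aE rC))) => x.
  move=> [x2 [xa [-> rx]]].
  have x0 : 0 < x by rewrite (lt_le_trans _ x2).
  have x1 : 1 <= x by rewrite (le_trans _ x2) // ler1n.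
  split; first by rewrite exprn_gt0.
  have xd : 0 < x ^+ d.+1 by rewrite exprn_gt0.
  have lnx : C * ln x <= C * x ^+ d.+1.
    rewrite ler_wpM2l // (le_trans (ltW (ln_sublinear x0))) //.
    by rewrite -[leLHS]expr1 ler_weXn2l.
  have -> : P.[x] + r x - L * x ^+ d.+2 = (P.[x] - L * x ^+ d.+2) + r x by ring.
  rewrite (le_trans (ler_normD _ _)) //.
  have := lerD (aP x x1) (le_trans rx lnx) => /le_trans; apply.
  rewrite -mulrDl [x ^+ d.+2]exprS mulrA ler_pM2r //.
  by move: xa; rewrite ler_pdivrMr //; lra.
have Lpos : 0 < L.
  have [x [[y0 yL] ay]] := filter_ex (filterI dom a0).
  rewrite lt0r L0 /= leNgt; apply/negP => Lneg.
  move: yL; rewrite (ltr0_norm Lneg) ler_distl => /andP[_].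
  by have : L * x ^+ d.+2 < 0; [rewrite pmulr_llt0 | lra].
exists (L / 2); first by rewrite divr_gt0.
apply: filterS dom => x [x0]; rewrite (gtr0_norm Lpos) ler_distl => /andP[h1 h2].
have : 0 < L * x ^+ d.+2 by rewrite mulr_gt0.
by move=> h; apply/andP; split; lra.
Qed.

(* Otherwise [f (B ^ k)] would grow faster than [C * ln (B ^ k)]. *)
Lemma slow_scale {R : realType} (f : R -> R) (C B : R) (k0 : nat) : 1 < B ->
  (forall k, (k0 <= k)%N -> `|f (B ^+ k)| <= C * ln (B ^+ k)) ->
  exists2 k, (k0 <= k)%N & f (B ^+ k.+1) - f (B ^+ k) <= C * ln B + 1.
Proof.
move=> B1 fC; apply: contrapT => nk.
have B0 : 0 < B by rewrite (lt_trans _ B1).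
have step j : f (B ^+ k0) + j%:R * (C * ln B + 1) <= f (B ^+ (k0 + j)).
  elim: j => [|j IH]; first by rewrite mul0r addr0 addn0.
  have : C * ln B + 1 < f (B ^+ (k0 + j).+1) - f (B ^+ (k0 + j)).
    by rewrite ltNge; apply/negP => h; apply: nk; exists (k0 + j)%N; rewrite ?leq_addr.
  by rewrite addnS -natr1; lra.
(* Each step exceeds the allowed growth [C * ln B] by 1; [j] such surpluses exhaust the room
   available at [k0]. *)
have [j jP] : exists j : nat, C * ln B * k0%:R - f (B ^+ k0) < j%:R.
  exists (Num.bound `|C * ln B * k0%:R - f (B ^+ k0)|).
  by rewrite (le_lt_trans (ler_norm _)) // archi_boundP.
have := step j; have := fC _ (leq_addr j k0).
rewrite lnXn // -[ln B *+ _]mulr_natr natrD => /(le_trans (ler_norm _)).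
by lra.
Qed.

Lemma exists_natX_gt {R : archiRealFieldType} (B : nat) (M : R) : (1 < B)%N ->
  exists k0, forall k, (k0 <= k)%N -> M < B%:R ^+ k.
Proof.
move=> B1; exists (Num.bound `|M|) => k k0k.
rewrite (le_lt_trans (ler_norm _)) // (lt_le_trans (archi_boundP _)) //.
by rewrite -natrX ler_nat (leq_trans k0k) // ltnW // ltn_expl.
Qed.

(** The growth bounds turn a range of values of [alpha] into a range of [x], and [slow_scale]
    supplies ranges on which the monotone [r] varies little. [V] is fixed before [T0], so it serves
    arbitrarily large scales. *)
Lemma small_variation {R : realType} (alpha r : R -> R) (d : nat) (b C : R) :
  0 < b ->
  (\forall x \near +oo_R, b * x ^+ d.+1 <= alpha x <= 4 * b * x ^+ d.+1) ->
  (\forall x \near +oo_R, `|r x| <= C * ln x) ->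
  eventually_ndecr r \/ eventually_ndecr (- r) ->
  exists V M, forall T0, exists T rho, T0 <= T /\
    forall x, M < x -> T <= alpha x <= 20 * T -> `|r x - rho| <= V.
Proof.
move=> b0 growth rC.
wlog: r rC / eventually_ndecr r => [wl|[a ra] _].
  move=> [ra|ra]; first by apply: wl => //; left.
  have [|V [M VM]] := wl (- r) _ ra (or_introl ra).
    by apply: filterS rC => x; rewrite normrN.
  exists V, M => T0; have [T [rho [T0T h]]] := VM T0.
  exists T, (- rho); split => // x Mx Tx; have := h x Mx Tx.
  have -> : r x - - rho = - (- r x - rho) by ring.
  by rewrite normrN.
have [M1 M1P] := (near_pinftyP _).1 (filterI growth rC).
pose M := Num.max 0 (Num.max M1 a).
exists (C * ln 80 + 1), M => T0.
have [k0 k0P] := @exists_natX_gt R 80 (Num.max M (T0 / (4 * b))) isT.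
have MP x : M < x -> [/\ 0 < x, M1 < x & a < x].
  by rewrite /M !gt_max => /and3P[].
have k0M k : (k0 <= k)%N -> M < 80 ^+ k.
  by move=> /k0P; rewrite gt_max => /andP[].
have [//|k /k0M Mk|k k0k slow] := @slow_scale R r C 80 k0 _ _.
- by rewrite ltr1n.
- by have [_ /M1P[]] := MP _ Mk.
set X : R := 80 ^+ k in slow.
have MX : M < X := k0M k k0k.
have X1 : 1 <= X by rewrite exprn_ege1 // ler1n.
have X0 : 0 < X by rewrite (lt_le_trans _ X1).
(* With this [T], [T <= alpha x] forces [X <= x], and [alpha x <= 20 * T] gives [x <= 80 * X], as
   [20 * 4 = 80]. *)
exists (4 * b * X ^+ d.+1), (r X); split.
  have : T0 / (4 * b) < X by have := k0P k k0k; rewrite gt_max => /andP[].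
  rewrite ltr_pdivrMr ?mulr_gt0 // => /ltW /le_trans; apply.
  rewrite mulrC ler_pM2l ?mulr_gt0 // exprS ler_peMr ?(ltW X0) //.
  exact: exprn_ege1.
move=> x Mx /andP[Tx xT]; have [x0 /M1P[/andP[g1 g2] _] ax] := MP _ Mx.
have Xx : X <= x.
  rewrite -(@ler_pXn2r _ d.+1) ?nnegrE ?(ltW X0) ?(ltW x0) //.
  by have := le_trans Tx g2; rewrite ler_pM2l ?mulr_gt0.
have xX : x <= 80 ^+ k.+1.
  have X'0 : 0 < (80 : R) ^+ k.+1 by rewrite exprn_gt0.
  rewrite -(@ler_pXn2r _ d.+1) ?nnegrE ?(ltW x0) ?(ltW X'0) //.
  have : b * x ^+ d.+1 <= b * (80 * X ^+ d.+1).
    by apply: le_trans g1 _; apply: le_trans xT _; lra.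
  rewrite ler_pM2l // => /le_trans; apply.
  rewrite (exprS _ k) -/X exprMn ler_pM2r ?exprn_gt0 //.
  by rewrite exprS ler_peMr // exprn_ege1 // ler1n.
have [_ _ aX] := MP _ MX.
have r1 := ra _ _ aX Xx; have r2 := ra _ _ ax xX.
by rewrite ger0_norm ?subr_ge0 //; lra.
Qed.

(** * Construction of the set *)

Lemma upper_density_gt0 {R : realType} (A : set nat) (delta : R) :
  0 < delta ->
  (forall N1 : nat, exists (N : nat) (s : seq nat),
    [/\ (N1 <= N)%N, (0 < N)%N, uniq s,
        forall k, k \in s -> A k /\ (1 <= k <= N)%N &
        delta * N%:R <= (size s)%:R]) ->
  (0 < upper_density R A)%E.
Proof.
move=> d0 h; apply: (@lt_le_trans _ _ delta%:E); first by rewrite lte_fin.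
apply: le_ereal_inf_tmp => _ [V [N1 _ N1V] <-].
have [N [s [N1N N0 us sA sN]]] := h N1.
apply: le_trans (ereal_sup_ubound _); last by exists N => //; exact: N1V.
rewrite lee_fin ler_pdivlMr ?ltr0n // (le_trans sN) // ler_nat.
have fin : finite_set (A `&` [set k | (1 <= k <= N)%N]).
  apply: (@sub_finite_set _ _ `I_N.+1); last exact: finite_II.
  by move=> k [_ /andP[_ kN]] /=; rewrite ltnS.
rewrite -(undup_id us) -card_fseq; apply: fsubset_leq_card; apply/fsubsetP => k; rewrite inE => ks.
by rewrite in_fset_set // inE; exact: sA.
Qed.

Lemma infinitely_often_pigeonhole {I : finType} (G : I -> nat -> Prop) :
  (forall m1, exists2 m, (m1 <= m)%N & exists u, G u m) ->
  exists u, forall m1, exists2 m, (m1 <= m)%N & G u m.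
Proof.
move=> h; apply: contrapT => /forallNP nu.
have [b bP] : {b : I -> nat & forall u m, (b u <= m)%N -> ~ G u m}.
  apply: (@choice _ _ (fun u b => forall m, (b <= m)%N -> ~ G u m)) => u.
  have /existsNP[m1 m1P] := nu u.
  by exists m1 => m m1m Gm; apply: m1P; exists m.
have [m bm [u Gm]] := h (\max_u b u).
by apply: bP Gm; rewrite (leq_trans _ bm) // leq_bigmax.
Qed.

(* [A] consists of the terms of the sequence [ceil (e m + v u)] with
   [m0 <= m < 2 m0] for [m0] in an infinite set of scales sharing the same [u].
   If [x <= y] in [A], the scale of [y] governs [x + y]. *)
Lemma avoiding_set {R : realType} {I : finType} (beta : nat -> R) (e : R)
    (v : I -> R) :
  1 <= e -> (forall u, 0 <= v u <= e) ->
  (forall m1 : nat, exists2 m0, (m1 <= m0)%N & exists u : I, forall n k : nat,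
     e * m0%:R <= beta n <= 9 * e * m0%:R ->
     ~ (e * k%:R + 2 * v u <= beta n < e * k%:R + 2 * v u + 3)) ->
  exists A : set nat,
    [/\ A `<=` [set k | (1 <= k)%N],
        (0 < upper_density R A)%E &
        ~ exists x y n : nat,
            [/\ A x, A y & (x + y)%N%:Z = Num.floor (beta n)]].
Proof.
move=> e1 vP /infinitely_often_pigeonhole[u uP].
have e0 : 0 < e by rewrite (lt_le_trans _ e1).
have /andP[v0 ve] := vP u.
set good := fun m0 : nat => forall n k : nat, _ in uP.
pose a (m : nat) : nat := `|Num.ceil (e * m%:R + v u)|%N.
have aP m : e * m%:R + v u <= (a m)%:R < e * m%:R + v u + 1.
  have em0 : 0 <= e * m%:R + v u by rewrite addr_ge0 ?mulr_ge0 // ltW.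
  have c0 : 0 <= Num.ceil (e * m%:R + v u) by rewrite ceil_ge0 (lt_le_trans _ em0) ?ltrN10.
  have -> : (a m)%:R = (Num.ceil (e * m%:R + v u))%:~R :> R.
    by rewrite -[LHS]/((a m)%:Z%:~R) gez0_abs.
  by have := ceil_itv (e * m%:R + v u); rewrite intrB => /andP[? ?]; apply/andP; split; lra.
have a_lt m n : (m < n)%N -> (a m < a n)%N.
  move=> mn; rewrite -(ltr_nat R).
  have /andP[_ am] := aP m; have /andP[an _] := aP n.
  have : e * (m%:R + 1) <= e * n%:R by rewrite ler_pM2l // natr1 ler_nat.
  by lra.
have a_inj : injective a.
  by move=> m n amn; case: (ltngtP m n) => // /a_lt; rewrite amn ltnn.
have a_ge m : (m <= a m)%N.
  by elim: m => // m /leq_ltn_trans; apply; exact: a_lt.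
exists [set x | exists m0 m : nat,
  [/\ (0 < m0)%N, good m0, (m0 <= m < m0 + m0)%N & x = a m]]; split.
- move=> _ [m0 [m [m00 _ /andP[m0m _] ->]]] /=.
  exact: leq_trans m00 (leq_trans m0m (a_ge m)).
(* The [m0] terms of a scale lie below [a (2 * m0)], which is less than [2 * e * m0 + e + 1], hence
   than [(3 * e + 1) * m0]. *)
- apply: (@upper_density_gt0 _ _ (3 * e + 1)^-1).
    by rewrite invr_gt0; lra.
  move=> N1; have [m0 N1m0 gm0] := uP N1.+1.
  have m00 : (0 < m0)%N by exact: leq_trans N1m0.
  exists (a (m0 + m0)%N), [seq a m | m <- iota m0 m0]; split.
  + by rewrite (leq_trans _ (a_ge _)) // (leq_trans (ltnW N1m0)) // leq_addr.
  + by rewrite (leq_trans _ (a_ge _)) // addn_gt0 m00.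
  + by rewrite map_inj_uniq // iota_uniq.
  + move=> k /mapP[m]; rewrite mem_iota => /andP[m0m mm0] ->; split.
      by exists m0, m; split => //; rewrite m0m.
    by rewrite (leq_trans (leq_trans m00 m0m)) //= ltnW // a_lt.
  rewrite size_map size_iota mulrC ler_pdivrMr; last by lra.
  have /andP[_] := aP (m0 + m0)%N; rewrite natrD.
  have : 1 <= m0%:R :> R by rewrite ler1n.
  have : 0 <= (m0%:R - 1) * (e + 1) :> R.
    by rewrite mulr_ge0 ?subr_ge0 ?ler1n //; lra.
  by nra.
move=> [x [y [n [Ax Ay xyn]]]].
have {Ax Ay} [m0 [m [k [m00 gm0 mk0 mk1 xyE]]]] : exists m0 m k : nat,
    [/\ (0 < m0)%N, good m0, (m0 <= m + k)%N, (m + k < 4 * m0)%N &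
      (x + y = a m + a k)%N].
  have [[p [m [p0 gp /andP[pm mp] ->]]] [q [k [q0 gq /andP[qk kq] ->]]]] := (Ax, Ay).
  by case: (leqP p q) => pq; [exists q, m, k | exists p, m, k]; split => //; lia.
have /andP[b1 b2] : (x + y)%:R <= beta n < (x + y)%:R + 1.
  have := floor_itv (beta n); rewrite -xyn intrD.
  by rewrite -!pmulrn.
have /andP[m1 m2] := aP m; have /andP[k1 k2] := aP k.
have m01 : e <= e * m0%:R by rewrite ler_peMr ?ler1n // ltW.
have low : e * m0%:R <= e * (m + k)%:R by rewrite ler_pM2l // ler_nat.
have up : e * (m + k)%:R <= e * (4 * m0%:R).
  by rewrite ler_pM2l // -natrM ler_nat ltnW.
move: b1 b2; rewrite xyE !natrD in low up * => b1 b2.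
(* The window has length 3: two ceilings and the floor each lose at most 1. The factor 9 is
   [4 + 2 + 3], from [m + k < 4 * m0], [2 * v u <= 2 * e] and [3 <= 3 * e]. *)
by apply: (gm0 n (m + k)%N); rewrite ?natrD; apply/andP; split; lra.
Qed.

(* Here [t] is [s + ceil ((rho + V) / c)]: dividing by [c] leaves a window of
   length [1 + (2 V + 3) / c] after the residue [s] for [p n] mod [M]. *)
Lemma run_avoids_window {R : realType} (p : {poly int}) (c V rho x : R)
    (K M : nat) (s t n : int) :
  0 < c -> 1 + (2 * V + 3) / c < K%:R ->
  (forall i : nat, (i < K)%N -> missed_residue p M (s + i%:Z)) ->
  (M %| t - (s + Num.ceil ((rho + V) / c)))%Z ->
  `|x - rho| <= V -> forall k : int,
  ~ (c * M%:R * k%:~R + c * t%:~R <= c * p.[n]%:~R + x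
     < c * M%:R * k%:~R + c * t%:~R + 3).
Proof.
move=> c0 KV run /dvdzP[z tE] xV k /andP[lo hi].
set w := Num.ceil _ in tE.
have /andP[w1 w2] : (w - 1)%:~R < (rho + V) / c <= w%:~R := ceil_itv _.
rewrite ltr_pdivlMr // in w1; rewrite ler_pdivrMr // in w2.
have tER : t%:~R = z%:~R * M%:R + s%:~R + w%:~R :> R.
  by rewrite -[t](subrK (s + w)) tE !intrD intrM -pmulrn addrA.
(* [i] is the position of [p.[n]] in the run modulo [M]. The bound [x <= rho + V] gives [0 <= i],
   and [rho - V <= x] gives [c * i < c + 2 * V + 3], the summand [c] being due to the ceiling. *)
pose i : int := p.[n] - M%:Z * (k + z) - s.
have iE : i%:~R = p.[n]%:~R - M%:R * (k%:~R + z%:~R) - s%:~R :> R.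
  by rewrite /i !intrB intrM intrD -pmulrn.
move: xV; rewrite ler_distl => /andP[x1 x2].
rewrite tER in lo hi; rewrite intrB in w1.
have i0 : 0 <= i.
  by rewrite -(ler0z R) -(pmulr_rge0 _ c0) iE; lra.
have iK : i < K%:Z.
  rewrite -(ltr_int R) (le_lt_trans _ KV) // -(ler_pM2l c0) iE.
  have -> : c * (1 + (2 * V + 3) / c) = c + (2 * V + 3).
    by field; rewrite gt_eqF.
  by lra.
have iN : (`|i| < K)%N by rewrite -ltz_nat gez0_abs.
apply: (run _ iN n); rewrite gez0_abs // /i.
have -> : p.[n] - (s + (p.[n] - M%:Z * (k + z) - s)) = M%:Z * (k + z) by ring.
exact: dvdz_mulr.
Qed.

Theorem theorem1p4 (R : realType) (alpha r : R -> R) (c : R) (p : {poly int})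
    (alpha_subpoly : sub_polynomial alpha)
    (alpha_pos : \forall x \near +oo_R, 0 < alpha x)
    (c_pos : 0 < c)
    (deg_p : (2 <= (size p).-1)%N)
    (alphaE : \forall x \near +oo_R,
       alpha x = c * (map_poly intr p).[x] + r x)
    (r_log : exists l : R, `|r x| / ln x @[x --> +oo_R] --> l) :
  exists A : set nat,
    [/\ A `<=` [set k | (1 <= k)%N],
        (0 < upper_density R A)%E &
        ~ exists x y n : nat,
            [/\ A x, A y, (1 <= n)%N &
                (x + y)%N%:Z = Num.floor (alpha n%:R)]].
Proof.
pose P : {poly R} := c *: map_poly intr p.
have [d sp] : exists d, size p = d.+3 by exists ((size p) - 3)%N; lia.
have sP : size P = d.+3.
  by rewrite size_scale ?gt_eqF // (size_map_inj_poly intr_inj) ?sp.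
have alphaP : \forall x \near +oo_R, alpha x = P.[x] + r x.
  by apply: filterS alphaE => x ->; rewrite hornerZ.
have [l /eventually_bounded_by_ln[C C0 rC]] := r_log.
have [b b0 growth] := sub_poly_growth _ _ _ _ _ sP C0 alpha_pos alphaP rC.
(* Unlike [r], this remainder satisfies [alpha = P + r'] at every point. *)
pose r' := alpha - horner P.
have rr' : germ_eq r r' by apply: filterS alphaP => x xE; rewrite /r' fctE xE addrC addKr.
have r'C : \forall x \near +oo_R, `|r' x| <= C * ln x.
  by apply: filterS (filterI rr' rC) => x [<-].
have mono : eventually_ndecr r' \/ eventually_ndecr (- r').
  by have [[H hH Ha] _] := alpha_subpoly; exact: hardy_sub_poly_monotone Ha.
have [V [N0 VP]] := small_variation _ _ _ _ _ b0 growth r'C mono.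
have [K1 KV] : exists K, 1 + (2 * V + 3) / c < K%:R.
  exists (Num.bound `|1 + (2 * V + 3) / c|).
  by rewrite (le_lt_trans (ler_norm _)) // archi_boundP.
(* [K1] makes the run longer than the window; [K2] makes [M] large enough for [1 <= c * M]. *)
have [K2 Kc] : exists K : nat, c^-1 <= K%:R.
  exists (Num.bound `|c^-1|).
  by rewrite (le_trans (ler_norm _)) // ltW // archi_boundP.
have sp2 : (2 < size p)%N by rewrite sp.
have [M [s [M0 KM run]]] := missed_residue_run p (maxn K1 K2) sp2.
have {}run i : (i < K1)%N -> missed_residue p M (s + i%:Z).
  by move=> iK; apply: run; rewrite leq_max iK.
(* Halving [c * u] makes the sum of two terms of the sequence start at [c * u] modulo the period
   [e]. *)
pose e := c * M%:R; pose v (u : 'I_M) : R := c * (u : nat)%:R / 2.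
have e1 : 1 <= e.
  rewrite /e -ler_pdivrMl // mulr1 (le_trans Kc) // ler_nat.
  by rewrite (leq_trans _ KM) // leq_maxr.
have e0 : 0 < e by rewrite (lt_le_trans _ e1).
have vP u : 0 <= v u <= e.
  have uM : (u : nat)%:R <= M%:R :> R by rewrite ler_nat ltnW.
  have := ler_pM2l c_pos (u : nat)%:R M%:R; rewrite uM => cuM.
  have cu0 : 0 <= c * (u : nat)%:R by rewrite mulr_ge0 // ltW.
  by rewrite /v /e; apply/andP; split; lra.
(* [alpha] is uncontrolled at small integers; a value above [S] can only be taken beyond [N0]. *)
pose S : R := \sum_(n < (Num.bound `|N0|).+1) `|alpha n%:R|.
have big n : S < alpha n%:R -> N0 < n%:R.
  move=> Sn; rewrite (le_lt_trans (ler_norm _)) //.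
  rewrite (lt_le_trans (archi_boundP _)) // ler_nat leqNgt; apply/negP => nN.
  move: Sn; rewrite ltNge => /negP; apply.
  rewrite (le_trans (ler_norm _)) // /S.
  rewrite (bigD1 (Ordinal (ltnW nN : (n < (Num.bound `|N0|).+1)%N))) //= lerDl.
  exact: sumr_ge0.
have [|A [A1 Ad AN]] := @avoiding_set R 'I_M (fun n => alpha n%:R) e v e1 vP; last first.
  exists A; split => // -[x [y [n [Ax Ay _ xyn]]]].
  by apply: AN; exists x, y, n.
move=> m1; have [T [rho [TT0 TP]]] := VP (Num.max (S + 1) (e * (m1%:R + 1))).
have [ST mT] : S + 1 <= T /\ e * (m1%:R + 1) <= T.
  by move: TT0; rewrite ge_max => /andP.
have eT : e <= T by rewrite (le_trans _ mT) // ler_peMr ?(ltW e0) // lerDr.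
have T0 : 0 < T by rewrite (lt_le_trans e0).
(* Then [[e * m0, 9 * e * m0]] lies in [[T, 18 * T]], inside the range where [r'] is close to
   [rho]. *)
have [m0 [m0T Tm0]] : exists m0 : nat, T <= e * m0%:R /\ e * m0%:R <= 2 * T.
  have Te0 : 0 <= T / e by rewrite divr_ge0 // ltW.
  exists (Num.truncn (T / e)).+1.
  have /andP[] := truncn_itv Te0; rewrite ler_pdivlMr // ltr_pdivrMr // -natr1.
  by split; lra.
exists m0.
  have : e * m1%:R <= e * m0%:R by lra.
  by rewrite ler_pM2l // ler_nat.
pose w : int := s + Num.ceil ((rho + V) / c).
have M0z : M%:Z != 0 by rewrite -lt0n.
have uM : (`|(w %% M)%Z| < M)%N.
  by rewrite -ltz_nat gez0_abs ?modz_ge0 // ltz_pmod.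
exists (Ordinal uM) => n k /andP[an1 an2].
have uw : (M %| `|(w %% M)%Z|%:Z - w)%Z.
  by rewrite gez0_abs ?modz_ge0 // -eqz_mod_dvd modz_mod.
have Nn : N0 < n%:R by apply: big; lra.
have rn : `|r' n%:R - rho| <= V.
  by apply: TP => //; apply/andP; split; lra.
have := run_avoids_window _ _ _ _ _ _ _ _ _ n%:Z c_pos KV run uw rn k%:Z.
have -> : 2 * v (Ordinal uM) = c * `|(w %% M)%Z|%:Z%:~R.
  by rewrite /v /= mulrC divfK ?pnatr_eq0 // -pmulrn.
have -> : alpha n%:R = c * p.[n%:Z]%:~R + r' n%:R.
  rewrite -[r' _]/(alpha n%:R - P.[n%:R]) hornerZ.
  have -> : (map_poly intr p).[n%:R] = p.[n%:Z]%:~R :> R.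
    by rewrite -[n%:R]/(n%:Z%:~R) horner_map.
  by rewrite addrC subrK.
by [].
Qed.
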